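(* Let $P(y|x_1,x_2)$ be a discrete memoryless multiple access channel with finite alphabets, and let $P(x_1,x_2)$ be a fixed input distribution. Consider the following codes: - a common message $M_0\in\{1,\dots,2^{nR_0}\}$ is known to both encoders; - a private message $M_1\in\{1,\dots,2^{nR_1}\}$ is known only to Encoder 1; - Encoder 1 sends Encoder 2 a conference message $M_{12}\in\{1,\dots,2^{nR_{12}}\}$ that is a function of $(M_0,M_1)$; - Encoder 1 transmits $X_1^n$ as a function of $(M_0,M_1)$, and Encoder 2 transmits $X_2^n$ as a function of $(M_0,M_{12})$; - the decoder estimates $(M_0,M_1)$ from $Y^n$. For $\delta>0$, the error probability is the probability that either the messages are decoded incorrectly or the joint type of $(X_1^n,X_2^n,Y^n)$ is at total variation distance at least $\delta$ from $P(x_1,x_2)P(y|x_1,x_2)$. A pair $(R_0,R_1)$ is achievable if for every $\delta>0$ there are codes whose error probability tends to $0$ as $n\to\infty$. Then, for given $R_{12}$, the capacity region (closure of achievable pairs) is the set of $(R_0,R_1)$ satisfying $$R_0+R_1\le I(X_1,X_2;Y),\qquad R_1\le I(X_1;Y|X_2)+R_{12},$$ where $(X_1,X_2,Y)\sim P(x_1,x_2)P(y|x_1,x_2)$.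
   Context: Total variation distance is $\|p-q\|_{TV}=\frac12\sum|p-q|$. The joint type is the empirical distribution of the triple sequence. *)

(* Defs.v *)
From HB Require Import structures.
From mathcomp Require Import all_boot all_order all_algebra.
From mathcomp Require Import all_classical all_reals all_analysis.
Set Implicit Arguments. Unset Strict Implicit. Unset Printing Implicit Defensive.
Import Order.TTheory GRing.Theory Num.Theory.
Import numFieldNormedType.Exports.
Local Open Scope ring_scope.
Local Open Scope classical_set_scope.

Section Defs.
Variable R : realType.

Definition xlog2x (p : R) : R := if p == 0 then 0 else p * (ln p / ln 2).

Definition entropy (T : finType) (p : T -> R) : R := - \sum_(t : T) xlog2x (p t).

Variables (X1 X2 Y : finType).
Variables (P : X1 -> X2 -> R) (W : X1 -> X2 -> Y -> R).

Definition jointXY (x1 : X1) (x2 : X2) (y : Y) : R := P x1 x2 * W x1 x2 y.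
Definition marg12 (t : X1 * X2) : R := \sum_(y : Y) jointXY t.1 t.2 y.
Definition margY (y : Y) : R := \sum_(x1 : X1) \sum_(x2 : X2) jointXY x1 x2 y.
Definition marg2 (x2 : X2) : R := \sum_(x1 : X1) \sum_(y : Y) jointXY x1 x2 y.
Definition marg2Y (t : X2 * Y) : R := \sum_(x1 : X1) jointXY x1 t.1 t.2.
Definition joint123 (t : X1 * X2 * Y) : R := jointXY t.1.1 t.1.2 t.2.

Definition condH_Y_X1X2 : R := entropy joint123 - entropy marg12.
Definition condH_Y_X2 : R := entropy marg2Y - entropy marg2.
Definition mutinf_X1X2_Y : R := entropy margY - condH_Y_X1X2.
Definition condmutinf_X1_Y_X2 : R := condH_Y_X2 - condH_Y_X1X2.

Definition msize (n : nat) (r : R) : nat :=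
  maxn 1 `|Num.floor (powR 2 (n%:R * r))|%N.

Record code (n M0 M1 M12 : nat) := Code {
  conf : 'I_M0 -> 'I_M1 -> 'I_M12 ;
  enc1 : 'I_M0 -> 'I_M1 -> {ffun 'I_n -> X1} ;
  enc2 : 'I_M0 -> 'I_M12 -> {ffun 'I_n -> X2} ;
  dec  : {ffun 'I_n -> Y} -> 'I_M0 * 'I_M1 }.

Definition jtype n (a : {ffun 'I_n -> X1}) (b : {ffun 'I_n -> X2})
  (c : {ffun 'I_n -> Y}) (t : X1 * X2 * Y) : R :=
  #|[set i : 'I_n | (a i == t.1.1) && (b i == t.1.2) && (c i == t.2)]|%:R / n%:R.

Definition tv_to_PW n a b c : R :=
  2^-1 * \sum_(t : X1 * X2 * Y) `|@jtype n a b c t - joint123 t|.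

Definition Wn n (a : {ffun 'I_n -> X1}) (b : {ffun 'I_n -> X2})
  (c : {ffun 'I_n -> Y}) : R := \prod_(i < n) W (a i) (b i) (c i).

Definition perr n M0 M1 M12 (C : code n M0 M1 M12) (delta : R) : R :=
  (M0 * M1)%:R^-1 * \sum_(m0 : 'I_M0) \sum_(m1 : 'I_M1) \sum_(y : {ffun 'I_n -> Y})
    let x1 := enc1 C m0 m1 in
    let x2 := enc2 C m0 (conf C m0 m1) in
    Wn x1 x2 y *
      (if (dec C y != (m0, m1)) || (delta <= tv_to_PW x1 x2 y) then 1 else 0).

Definition achievable (R12 : R) : set (R * R) :=
  fun r => 0 <= r.1 /\ 0 <= r.2 /\
    forall delta : R, 0 < delta ->
      exists C : forall n, code n (msize n r.1) (msize n r.2) (msize n R12),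
        perr (C n) delta @[n --> \oo] --> 0%R.

End Defs.

(* Main.v *)
(* Everything is measured through the information densities ln (W / Q) and
   ln (W / V), with Q the output law and V the law of Y given X2.

   Direct part: superposition coding, where M12 is M1 modulo its range, the X2
   words are drawn i.i.d. for each (m0, m12) and the X1 words conditionally on
   them. The decoder looks for a codeword pair whose joint type is close to P W
   and whose two densities are large. By Markov's inequality an independent word
   pair looks good with probability at most exp(- n I(X1,X2;Y)), and one sharing
   the X2 word with probability at most exp(- n I(X1;Y|X2)), up to epsilon; the
   sent pair looks good by Chebyshev's inequality for the joint type.

   Converse: no Fano inequality is needed, since success forces the joint type to
   be close to P W. Then W^n is at most exp(n (I + epsilon)) times a fixed product
   law (Q or V, mixed with the uniform law so that no density is infinite), and
   the masses of the disjoint decoding sets under that law add up to at most 1. *)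

Require Import Defs.
From HB Require Import structures.
From mathcomp Require Import all_boot all_order all_algebra.
From mathcomp Require Import all_classical all_reals all_analysis.
From mathcomp Require Import ring lra.
Import Order.TTheory GRing.Theory Num.Theory.
Import numFieldNormedType.Exports.
Local Open Scope ring_scope.
Local Open Scope classical_set_scope.

Set Implicit Arguments. Unset Strict Implicit. Unset Printing Implicit Defensive.

(** * Product laws *)

Section ProductLaws.
Variables (R : realType) (I T : finType).
Implicit Types p : I -> T -> R.

Lemma sum_prod_law p : (forall i, \sum_t p i t = 1) ->
  \sum_(z : {ffun I -> T}) \prod_i p i (z i) = 1.
Proof. by move=> h; rewrite -bigA_distr_bigA big1. Qed.

(** No normalisation of [p] is assumed, so the factor at [k] may carry an indicator; this is how the
    case of two coordinates is reduced to one. *)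
Lemma expect_coord_unnorm p k (f : T -> R) :
  \sum_(z : {ffun I -> T}) (\prod_i p i (z i)) * f (z k) =
  (\sum_t p k t * f t) * \prod_(i | i != k) \sum_t p i t.
Proof.
pose F i t := p i t * (if i == k then f t else 1).
transitivity (\sum_(z : {ffun I -> T}) \prod_i F i (z i)).
  apply: eq_bigr => z _; rewrite big_split /=; congr (_ * _).
  by rewrite -big_mkcond /= big_pred1_eq.
rewrite -bigA_distr_bigA (bigD1 k) //=; congr (_ * _).
  by apply: eq_bigr => t _; rewrite /F eqxx.
apply: eq_bigr => i /negPf ik; apply: eq_bigr => t _.
by rewrite /F ik mulr1.
Qed.

Lemma expect_coord p k (f : T -> R) : (forall i, \sum_t p i t = 1) ->
  \sum_(z : {ffun I -> T}) (\prod_i p i (z i)) * f (z k) =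
  \sum_t p k t * f t.
Proof. by move=> h; rewrite expect_coord_unnorm [X in _ * X]big1 ?mulr1. Qed.

Lemma expect_coord2 p k l (f : T -> T -> R) : k != l ->
  (forall i, \sum_t p i t = 1) ->
  \sum_(z : {ffun I -> T}) (\prod_i p i (z i)) * f (z k) (z l) =
  \sum_s \sum_t p k s * (p l t * f s t).
Proof.
move=> kl h.
(* Fixing the value [s] of coordinate [k] leaves an unnormalised product law, under which only
   coordinate [l] remains to be averaged. *)
pose q s i t := p i t * (if i == k then (t == s)%:R else 1).
transitivity (\sum_s \sum_(z : {ffun I -> T}) (\prod_i q s i (z i)) * f s (z l)).
  rewrite exchange_big; apply: eq_bigr => z _ /=.
  have qE s : \prod_i q s i (z i) = (\prod_i p i (z i)) * (z k == s)%:R.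
    by rewrite big_split /= -big_mkcond /= big_pred1_eq.
  rewrite (bigD1 (z k)) //= qE eqxx mulr1 [X in _ + X]big1 ?addr0 // => s sk.
  by rewrite qE eq_sym (negPf sk) mulr0 mul0r.
apply: eq_bigr => s _; rewrite expect_coord_unnorm mulrC (bigD1 k) //=.
rewrite [X in _ * X * _]big1 => [|i /andP[il ik]]; last first.
  rewrite -[RHS](h i); apply: eq_bigr => t _.
  by rewrite /q (negPf ik) mulr1.
rewrite mulr1 (bigD1 s) //= [X in _ + X]big1 => [|t ts]; last first.
  by rewrite /q eqxx (negPf ts) mulr0.
rewrite {1}/q !eqxx mulr1 addr0 mulr_sumr; apply: eq_bigr => t _.
by rewrite /q eq_sym (negPf kl) mulr1.
Qed.

End ProductLaws.

(** Variance of an i.i.d. sum: distinct letters are independent and [g] is centred, so only the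
    diagonal terms survive. *)
Lemma expect_sqr_sum_iid (R : realType) (T : finType) (p g : T -> R) n :
  \sum_t p t = 1 -> \sum_t p t * g t = 0 ->
  \sum_(z : {ffun 'I_n -> T}) (\prod_i p (z i)) * (\sum_i g (z i)) ^+ 2 =
  n%:R * \sum_t p t * g t ^+ 2.
Proof.
move=> p1 pg0; have p1' (i : 'I_n) : \sum_t p t = 1 by [].
transitivity (\sum_(i < n) \sum_(j < n) \sum_(z : {ffun 'I_n -> T})
    (\prod_i p (z i)) * (g (z i) * g (z j))).
  rewrite pair_big exchange_big; apply: eq_bigr => z _ /=.
  rewrite expr2 mulr_suml -mulr_sumr; congr (_ * _).
  rewrite -(pair_big xpredT xpredT (fun i j => g (z i) * g (z j))) /=.
  by apply: eq_bigr => i _; rewrite mulr_sumr.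
rewrite -[X in X%:R]card_ord -sum1_card natr_sum mulr_suml.
apply: eq_bigr => i _; rewrite mul1r (bigD1 i) //=.
rewrite (expect_coord (p := (fun=> p)) i (fun t => g t * g t)) //.
rewrite [X in _ + X]big1 ?addr0 // => j ji.
rewrite (expect_coord2 (p := (fun=> p)) (k := i) (l := j) (fun s t => g s * g t)) 1?eq_sym //.
rewrite big1 // => s _.
transitivity (p s * g s * \sum_t p t * g t); last by rewrite pg0 mulr0.
by rewrite mulr_sumr; apply: eq_bigr => t _; ring.
Qed.

(** First-moment principle of random coding: some codebook does no worse than the average. *)
Lemma ex_le_average (R : realType) (T : finType) (p f : T -> R) B :
  (forall t, 0 <= p t) -> \sum_t p t = 1 -> \sum_t p t * f t <= B ->
  exists t, f t <= B.
Proof.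
move=> p0 p1 pfB; apply/not_existsP => h.
have fB t : B < f t by rewrite ltNge; apply/negP/h.
suff : \sum_t p t * B < \sum_t p t * f t.
  by rewrite -mulr_suml p1 mul1r ltNge pfB.
rewrite lt_neqAle ler_sum ?andbT; last first.
  by move=> t _; rewrite ler_wpM2l // ltW.
apply/negP => /eqP eqS.
have : \sum_t p t * (f t - B) = 0.
  apply/eqP; under eq_bigr do rewrite mulrBr.
  by rewrite sumrB eqS subrr.
move=> /eqP; rewrite psumr_eq0 => [/allP h0|t _]; last first.
  by rewrite mulr_ge0 // subr_ge0 ltW.
have : \sum_t p t = 0.
  apply: big1 => t _; have := h0 t (mem_index_enum _).
  by rewrite /= mulf_eq0 subr_eq0 (gt_eqF (fB t)) orbF => /eqP.
by rewrite p1 => /eqP; rewrite oner_eq0.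
Qed.

(** * Superposition coding *)

Section Superposition.
Variables (R : realType) (S0 S1 S12 A B Z : finType) (conf : S1 -> S12).
Variables (pB : B -> R) (pA : B -> A -> R) (w : A -> B -> Z -> R).
Variable G : A -> B -> Z -> bool.
Hypotheses (pB0 : forall b, 0 <= pB b) (pB1 : \sum_b pB b = 1).
Hypotheses (pA0 : forall b a, 0 <= pA b a) (pA1 : forall b, \sum_a pA b a = 1).
Hypothesis w0 : forall a b z, 0 <= w a b z.

(** Law of a cloud: a centre word with one satellite word per private message, the satellites being
    independent given the centre. *)
Definition cloud (u : B * {ffun S1 -> A}) := pB u.1 * \prod_j pA u.1 (u.2 j).

Lemma cloud_ge0 u : 0 <= cloud u.
Proof. by rewrite mulr_ge0 ?prodr_ge0. Qed.

Lemma expect_cloud1 j (f : B -> A -> R) :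
  \sum_u cloud u * f u.1 (u.2 j) = \sum_b pB b * \sum_a pA b a * f b a.
Proof.
rewrite -(pair_bigA _ (fun b (v : {ffun S1 -> A}) => cloud (b, v) * f b (v j))) /=.
apply: eq_bigr => b _; rewrite -(expect_coord (p := fun=> pA b) j) //.
by rewrite mulr_sumr; apply: eq_bigr => v _; rewrite mulrA.
Qed.

Lemma expect_cloud2 j j' (f : B -> A -> A -> R) : j != j' ->
  \sum_u cloud u * f u.1 (u.2 j) (u.2 j') =
  \sum_b pB b * \sum_a \sum_a' pA b a * (pA b a' * f b a a').
Proof.
move=> jj'; rewrite -(pair_bigA _ (fun b (v : {ffun S1 -> A}) =>
  cloud (b, v) * f b (v j) (v j'))) /=.
apply: eq_bigr => b _; rewrite -(expect_coord2 (p := fun=> pA b) _ jj') //.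
by rewrite mulr_sumr; apply: eq_bigr => v _; rewrite mulrA.
Qed.

Definition joint_expect (f : A -> B -> R) : R :=
  \sum_b pB b * \sum_a pA b a * f a b.

Definition out (z : Z) : R := joint_expect (fun a b => w a b z).
Definition cond_out (b : B) (z : Z) : R := \sum_a pA b a * w a b z.

Lemma joint_expect_ge0 f : (forall a b, 0 <= f a b) -> 0 <= joint_expect f.
Proof.
move=> f0; apply: sumr_ge0 => b _; rewrite mulr_ge0 // sumr_ge0 // => a _.
by rewrite mulr_ge0.
Qed.

Lemma ler_joint_expect f g : (forall a b, f a b <= g a b) ->
  joint_expect f <= joint_expect g.
Proof.
move=> fg; apply: ler_sum => b _; rewrite ler_wpM2l //; apply: ler_sum => a _.
by rewrite ler_wpM2l.
Qed.

Lemma joint_expect_cst k : joint_expect (fun _ _ => k) = k.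
Proof.
rewrite /joint_expect; under eq_bigr do rewrite -mulr_suml pA1 mul1r.
by rewrite -mulr_suml pB1 mul1r.
Qed.

Lemma sum_cloud : \sum_u cloud u = 1.
Proof.
rewrite -(pair_bigA _ (fun b (v : {ffun S1 -> A}) => cloud (b, v))) /= -pB1.
apply: eq_bigr => b _; rewrite /cloud /= -mulr_sumr.
by rewrite (sum_prod_law (p := fun=> pA b)) // mulr1.
Qed.

Local Notation codebook := {ffun S0 * S12 -> B * {ffun S1 -> A}}.
Definition codebook_law (cb : codebook) : R := \prod_l cloud (cb l).
Definition word1 (cb : codebook) (m : S0 * S1) : A := (cb (m.1, conf m.2)).2 m.2.
Definition word2 (cb : codebook) (m : S0 * S1) : B := (cb (m.1, conf m.2)).1.

(** The three sources of error: the sent pair fails the test [G]; a pair independent of the output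
    passes it; a pair sharing only its centre with the sent pair passes it. *)
Definition miss_prob : R := joint_expect (fun a b => \sum_z w a b z * (~~ G a b z)%:R).
Definition joint_confusion : R := joint_expect (fun a b => \sum_z out z * (G a b z)%:R).
Definition cond_confusion : R := joint_expect (fun a b => \sum_z cond_out b z * (G a b z)%:R).

Lemma expect_miss m : \sum_cb codebook_law cb *
    \sum_z w (word1 cb m) (word2 cb m) z * (~~ G (word1 cb m) (word2 cb m) z)%:R
  = miss_prob.
Proof.
pose f b a := \sum_z w a b z * (~~ G a b z)%:R.
transitivity (\sum_u cloud u * f u.1 (u.2 m.2)).
  by rewrite -(expect_coord (p := fun=> cloud) (m.1, conf m.2)) // => _; exact: sum_cloud.
by rewrite expect_cloud1.
Qed.

(** Different labels select independent clouds, so for the competitor [m'] the output has law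
    [out]. *)
Lemma expect_joint_confusion m m' : (m.1, conf m.2) != (m'.1, conf m'.2) ->
  \sum_cb codebook_law cb *
    \sum_z w (word1 cb m) (word2 cb m) z * (G (word1 cb m') (word2 cb m') z)%:R
  = joint_confusion.
Proof.
move=> ll'.
pose f (u u' : B * {ffun S1 -> A}) :=
  \sum_z w (u.2 m.2) u.1 z * (G (u'.2 m'.2) u'.1 z)%:R.
transitivity (\sum_u \sum_u' cloud u * (cloud u' * f u u')).
  by rewrite -(expect_coord2 (p := fun=> cloud) _ ll') // => _; exact: sum_cloud.
rewrite exchange_big /=.
transitivity (\sum_u' cloud u' * \sum_z out z * (G (u'.2 m'.2) u'.1 z)%:R).
  apply: eq_bigr => u' _; rewrite /f.
  under eq_bigr do rewrite mulrCA.
  rewrite -mulr_sumr; congr (_ * _).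
  under eq_bigr do rewrite mulr_sumr.
  rewrite exchange_big /=; apply: eq_bigr => z _.
  under eq_bigr do rewrite mulrA.
  rewrite -mulr_suml; congr (_ * _).
  by rewrite (expect_cloud1 m.2 (fun b a => w a b z)).
by rewrite (expect_cloud1 m'.2 (fun b a => \sum_z out z * (G a b z)%:R)).
Qed.

(** Same centre, different satellites: given the centre [b], the competing satellite is independent
    of the output, whose law is then [cond_out b]. *)
Lemma expect_cond_confusion m m' : (m.1, conf m.2) = (m'.1, conf m'.2) ->
  m.2 != m'.2 ->
  \sum_cb codebook_law cb *
    \sum_z w (word1 cb m) (word2 cb m) z * (G (word1 cb m') (word2 cb m') z)%:R
  = cond_confusion.
Proof.
move=> ll' mm'; rewrite /word1 /word2 -ll'.
pose f (u : B * {ffun S1 -> A}) :=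
  \sum_z w (u.2 m.2) u.1 z * (G (u.2 m'.2) u.1 z)%:R.
transitivity (\sum_u cloud u * f u).
  by rewrite -(expect_coord (p := fun=> cloud) (m.1, conf m.2)) // => _; exact: sum_cloud.
rewrite (expect_cloud2 (fun b a a' => \sum_z w a b z * (G a' b z)%:R) mm').
apply: eq_bigr => b _; congr (_ * _); rewrite exchange_big /=.
apply: eq_bigr => a' _.
under eq_bigr do rewrite mulrCA.
rewrite -mulr_sumr; congr (_ * _).
under [LHS]eq_bigr do rewrite mulr_sumr.
rewrite exchange_big /=; apply: eq_bigr => z _.
under [LHS]eq_bigr do rewrite mulrA.
by rewrite -mulr_suml.
Qed.

(** The default [m0] is returned when no message passes, a case already counted as a failure of the
    sent pair. *)
Definition decoder m0 (cb : codebook) (z : Z) : S0 * S1 :=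
  odflt m0 [pick m | G (word1 cb m) (word2 cb m) z].

(** Union bound: if the sent message passes, a wrong decision is itself another message that
    passes. *)
Lemma decoder_error_le m0 cb m z :
  ((decoder m0 cb z != m) || ~~ G (word1 cb m) (word2 cb m) z)%:R <=
  (~~ G (word1 cb m) (word2 cb m) z)%:R +
  \sum_(m' | m' != m) (G (word1 cb m') (word2 cb m') z)%:R :> R.
Proof.
case: (boolP (G _ _ z)) => Gm /=; last by rewrite orbT lerDl sumr_ge0.
rewrite orbF add0r /decoder; case: pickP => [m' Gm'|/(_ m)]; last by rewrite Gm.
case: eqP => [|/eqP] mm' /=; first exact: sumr_ge0.
by rewrite (bigD1 m') //= Gm' lerDl sumr_ge0.
Qed.

(** The total error is averaged over random codebooks. [K] bounds how many other private messages
    share the conference message of a given one. *)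
Lemma superposition_coding (m0 : S0 * S1) (K : nat) :
  (forall j, #|[pred j' | (j' != j) && (conf j' == conf j)]| <= K)%N ->
  exists (x1 : S0 -> S1 -> A) (x2 : S0 -> S12 -> B) (dec : Z -> S0 * S1),
  \sum_m \sum_z w (x1 m.1 m.2) (x2 m.1 (conf m.2)) z *
    ((dec z != m) || ~~ G (x1 m.1 m.2) (x2 m.1 (conf m.2)) z)%:R <=
  #|{: S0 * S1}|%:R *
    (joint_expect (fun a b => \sum_z w a b z * (~~ G a b z)%:R) +
     #|{: S0 * S1}|.-1%:R *
       joint_expect (fun a b => \sum_z out z * (G a b z)%:R) +
     K%:R * joint_expect (fun a b => \sum_z cond_out b z * (G a b z)%:R)).
Proof.
move=> HK; rewrite -/miss_prob -/joint_confusion -/cond_confusion.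
have out0 z : 0 <= out z by apply: joint_expect_ge0.
have cout0 b z : 0 <= cond_out b z by apply: sumr_ge0 => a _; rewrite mulr_ge0.
have indep0 : 0 <= joint_confusion.
  by apply: joint_expect_ge0 => a b; apply: sumr_ge0 => z _; rewrite mulr_ge0.
have cindep0 : 0 <= cond_confusion.
  by apply: joint_expect_ge0 => a b; apply: sumr_ge0 => z _; rewrite mulr_ge0.
pose err cb m := \sum_z w (word1 cb m) (word2 cb m) z *
  ((decoder m0 cb z != m) || ~~ G (word1 cb m) (word2 cb m) z)%:R.
suff [cb cbP] : exists cb, \sum_m err cb m <= #|{: S0 * S1}|%:R *
    (miss_prob + #|{: S0 * S1}|.-1%:R * joint_confusion + K%:R * cond_confusion).
  exists (fun m0 m1 => word1 cb (m0, m1)), (fun m0 k => (cb (m0, k)).1).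
  exists (decoder m0 cb); apply: le_trans cbP; apply: ler_sum => -[i j] _ /=.
  by [].
have codebook_law_ge0 cb : 0 <= codebook_law cb by apply: prodr_ge0 => l _; exact: cloud_ge0.
apply: (ex_le_average codebook_law_ge0).
  by rewrite (sum_prod_law (p := fun=> cloud)) // => _; exact: sum_cloud.
under eq_bigr do rewrite mulr_sumr.
rewrite exchange_big /= -sum1_card natr_sum mulr_suml.
apply: ler_sum => m _; rewrite mul1r.
pose conflict cb m' := \sum_z w (word1 cb m) (word2 cb m) z *
  (G (word1 cb m') (word2 cb m') z)%:R.
apply: (@le_trans _ _ (miss_prob + \sum_(m' | m' != m) \sum_cb codebook_law cb * conflict cb m')).
  rewrite -(expect_miss m) exchange_big /= -big_split /=.
  apply: ler_sum => cb _; rewrite -mulr_sumr -mulrDr ler_wpM2l //.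
  rewrite /conflict exchange_big -big_split /=; apply: ler_sum => z _.
  by rewrite -mulr_sumr -mulrDr ler_wpM2l // decoder_error_le.
rewrite -addrA lerD2l.
(* Every competitor is charged [joint_confusion], and those in the same cloud are charged
   [cond_confusion] on top. *)
pose close (m' : S0 * S1) := (m.1, conf m.2) == (m'.1, conf m'.2).
apply: (@le_trans _ _ (\sum_(m' | m' != m) (joint_confusion + (close m')%:R * cond_confusion))).
  apply: ler_sum => m' mm'; case: (boolP (close m')) => ll'.
    rewrite expect_cond_confusion ?(eqP ll') ?mul1r ?lerDr //.
    apply: contra mm'; move: ll' => /eqP[]; case: (m) (m') => [i j] [i' j'] /=.
    by move=> -> _ /eqP->.
  by rewrite (expect_joint_confusion ll') mul0r addr0.
rewrite big_split /= sumr_const mulr_natl -mulr_suml lerD //.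
  rewrite -[_ *+ _]mulr_natl -[leRHS]mulr_natl ler_wpM2r // ler_nat.
  by rewrite sum1_card (eq_card (B := predC1 m)) ?cardC1.
rewrite ler_wpM2r // -natr_sum ler_nat (leq_trans _ (HK m.2)) //.
rewrite -big_mkcondr /= sum1_card.
(* Competitors in the same cloud have common message [m.1], so they are images of the private
   messages counted by [K]. *)
apply: leq_trans (leq_image_card (pair m.1) _).
apply/subset_leq_card/fintype.subsetP => -[i' j'].
rewrite unfold_in /close xpair_eqE /= => /andP[ne /andP[/eqP i'E /eqP cc]].
subst i'; apply/fintype.imageP; exists j' => //; rewrite inE -cc eqxx andbT.
by apply: contra ne => /eqP ->; rewrite -surjective_pairing.
Qed.

End Superposition.

(** * Joint types *)

Section Types.
Variables (R : realType) (X1 X2 Y : finType).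
Variables (P : X1 -> X2 -> R) (W : X1 -> X2 -> Y -> R).
Hypotheses (HP0 : forall x1 x2, 0 <= P x1 x2)
  (HP1 : \sum_(x1 : X1) \sum_(x2 : X2) P x1 x2 = 1)
  (HW0 : forall x1 x2 y, 0 <= W x1 x2 y)
  (HW1 : forall x1 x2, \sum_(y : Y) W x1 x2 y = 1).
Implicit Types (n : nat) (V : X2 -> Y -> R).
Local Notation PW := (joint123 P W).

Lemma joint123_ge0 t : 0 <= PW t.
Proof. exact: mulr_ge0. Qed.

Lemma sum_triple (F : X1 * X2 * Y -> R) :
  \sum_t F t = \sum_x1 \sum_x2 \sum_y F (x1, x2, y).
Proof. by rewrite (pair_bigA _ (fun x1 x2 => _)) /= pair_bigA /=; apply: eq_bigr => -[[]]. Qed.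

Lemma sum_joint123 : \sum_t PW t = 1.
Proof.
rewrite sum_triple -HP1; apply: eq_bigr => x1 _; apply: eq_bigr => x2 _.
by rewrite /joint123 /jointXY /= -mulr_sumr HW1 mulr1.
Qed.

Lemma card_letters n (a : {ffun 'I_n -> X1}) (b : {ffun 'I_n -> X2})
    (c : {ffun 'I_n -> Y}) t :
  #|[set i | (a i == t.1.1) && (b i == t.1.2) && (c i == t.2)]|%:R =
  \sum_i ((a i, b i, c i) == t)%:R :> R.
Proof.
rewrite -sum1_card natr_sum big_mkcond /=; apply: eq_bigr => i _.
have -> : (i \in [set i | (a i == t.1.1) && (b i == t.1.2) && (c i == t.2)]) =
    ((a i, b i, c i) == t).
  by apply/idP/idP; rewrite inE /=; case: t => -[x1 x2] y /=; rewrite !xpair_eqE.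
by case: ifP.
Qed.

Lemma sum_letters n (a : {ffun 'I_n -> X1}) (b : {ffun 'I_n -> X2})
    (c : {ffun 'I_n -> Y}) (f : X1 * X2 * Y -> R) : (0 < n)%N ->
  \sum_i f (a i, b i, c i) = n%:R * \sum_t jtype R a b c t * f t.
Proof.
move=> n0; rewrite mulr_sumr.
transitivity (\sum_t \sum_i ((a i, b i, c i) == t)%:R * f t).
  rewrite exchange_big; apply: eq_bigr => i _ /=.
  rewrite (bigD1 (a i, b i, c i)) //= eqxx mul1r big1 ?addr0 // => t ti.
  by rewrite eq_sym (negPf ti) mul0r.
apply: eq_bigr => t _; rewrite -mulr_suml /jtype card_letters mulrA.
by rewrite (mulrC n%:R) divfK // pnatr_eq0 -lt0n.
Qed.

(** Twice the total variation is the l1 distance, and each [|f t|] is at most the sum of all of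
    them. *)
Lemma tv_expect n (a : {ffun 'I_n -> X1}) (b : {ffun 'I_n -> X2})
    (c : {ffun 'I_n -> Y}) (f : X1 * X2 * Y -> R) :
  `|\sum_t jtype R a b c t * f t - \sum_t PW t * f t| <=
  2 * tv_to_PW P W a b c * \sum_t `|f t|.
Proof.
rewrite -sumrB /tv_to_PW mulrA divff // mul1r mulr_suml.
apply: le_trans (ler_norm_sum _ _ _) _; apply: ler_sum => t _.
rewrite -mulrBl normrM ler_wpM2l // (bigD1 t) //= lerDl.
by apply: sumr_ge0.
Qed.

(** Information density in nats. As [ln] is total, positivity of the products, hence of all factors,
    is required where the density is exponentiated. *)
Definition logratio V (t : X1 * X2 * Y) : R :=
  ln (W t.1.1 t.1.2 t.2) - ln (V t.1.2 t.2).

Definition info V : R := \sum_t PW t * logratio V t.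

Definition Vn V n (b : {ffun 'I_n -> X2}) (c : {ffun 'I_n -> Y}) : R :=
  \prod_i V (b i) (c i).

Lemma expR_sum_ln (I : finType) (f : I -> R) : (forall i, 0 <= f i) ->
  0 < \prod_i f i -> expR (\sum_i ln (f i)) = \prod_i f i.
Proof.
move=> f0 /lt0r_neq0 /prodf_neq0 fn0; rewrite expR_sum.
by apply: eq_bigr => i _; rewrite lnK // posrE lt_neqAle eq_sym fn0 //=.
Qed.

Lemma Wn_Vn V n (a : {ffun 'I_n -> X1}) b c : (forall x2 y, 0 <= V x2 y) ->
  (0 < n)%N -> 0 < Wn W a b c -> 0 < Vn V b c ->
  Wn W a b c = expR (n%:R * \sum_t jtype R a b c t * logratio V t) * Vn V b c.
Proof.
move=> V0 n0 Wp Vp; rewrite -sum_letters // sumrB expRB.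
by rewrite !expR_sum_ln // divfK // lt0r_neq0.
Qed.

(** The exponent of the likelihood ratio is an expectation under the joint type, hence continuous in
    total variation, uniformly in [n]. *)
Lemma Wn_typical V (e : R) : (forall x2 y, 0 <= V x2 y) -> 0 < e ->
  exists2 d : R, 0 < d &
  forall n (a : {ffun 'I_n -> X1}) b c, (0 < n)%N ->
    tv_to_PW P W a b c < d -> 0 < Wn W a b c -> 0 < Vn V b c ->
    expR (n%:R * (info V - e)) * Vn V b c <= Wn W a b c <=
    expR (n%:R * (info V + e)) * Vn V b c.
Proof.
move=> V0 e0; pose S := \sum_t `|logratio V t|.
have S0 : 0 <= S by exact: sumr_ge0.
(* This makes [2 * d * S] at most [e]; the added 1 keeps the denominator positive when [S] is 0. *)
exists (e / (2 * (S + 1))) => [|n a b c n0 tvd Wp Vp].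
  by rewrite divr_gt0 // mulr_gt0 // ltr_wpDl.
rewrite (Wn_Vn V0 n0 Wp Vp) !ler_pM2r // !ler_expR !ler_pM2l ?ltr0n //.
rewrite -ler_distl; apply: le_trans (tv_expect a b c _) _.
have := S0; rewrite -/S; move: tvd; rewrite ltr_pdivlMr ?mulr_gt0 ?ltr_wpDl //.
have : 0 <= tv_to_PW P W a b c by rewrite mulr_ge0 ?invr_ge0 // sumr_ge0.
by move: (tv_to_PW _ _ _ _ _) => t; nra.
Qed.

Definition Pn n (a : {ffun 'I_n -> X1}) (b : {ffun 'I_n -> X2}) : R :=
  \prod_i P (a i) (b i).

Lemma big_ffun_triple n (F : {ffun 'I_n -> X1 * X2 * Y} -> R) :
  \sum_z F z = \sum_(a : {ffun 'I_n -> X1}) \sum_(b : {ffun 'I_n -> X2})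
    \sum_(c : {ffun 'I_n -> Y}) F [ffun i => (a i, b i, c i)].
Proof.
rewrite (pair_bigA _ (fun a b => _)) /= pair_bigA /=.
pose h (abc : {ffun 'I_n -> X1} * {ffun 'I_n -> X2} * {ffun 'I_n -> Y}) :=
  [ffun i => (abc.1.1 i, abc.1.2 i, abc.2 i)].
pose h' (z : {ffun 'I_n -> X1 * X2 * Y}) :=
  ([ffun i => (z i).1.1], [ffun i => (z i).1.2], [ffun i => (z i).2]).
apply: (reindex h); exists h' => [[[a b] c]|z] _; rewrite /h /h' /=.
  by congr (_, _, _); apply/ffunP => i; rewrite !ffunE.
by apply/ffunP => i; rewrite !ffunE /=; case: (z i) => -[].
Qed.

(** Chebyshev's inequality for every letter frequency: the indicator of an atypical type is
    dominated by [k] times the sum of squared deviations, whose mean is of order [1 / n]. *)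
Lemma atypical_prob (d : R) : 0 < d -> exists2 K : R, 0 <= K &
  forall n, (0 < n)%N ->
  \sum_(a : {ffun 'I_n -> X1}) \sum_(b : {ffun 'I_n -> X2})
    \sum_(c : {ffun 'I_n -> Y})
      Pn a b * Wn W a b c * (d <= tv_to_PW P W a b c)%R%:R <= K / n%:R.
Proof.
move=> d0; pose N := #|{: X1 * X2 * Y}|.
pose k : R := (N%:R / (2 * d)) ^+ 2.
have N0 : (0 < N)%N.
  rewrite /N lt0n; apply/negP => /eqP/card0_eq h.
  have : \sum_t PW t = 0 by apply: big1 => t; have := h t; rewrite inE.
  by rewrite sum_joint123 => /eqP; rewrite oner_eq0.
pose g t s : R := (s == t)%:R - PW t.
have k0 : 0 <= k by exact: sqr_ge0.
exists (k * \sum_t \sum_s PW s * g t s ^+ 2) => [|n n0].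
  rewrite mulr_ge0 // sumr_ge0 // => t _; rewrite sumr_ge0 // => s _.
  by rewrite mulr_ge0 ?sqr_ge0 ?joint123_ge0.
have n0' : n%:R != 0 :> R by rewrite pnatr_eq0 -lt0n.
apply: (@le_trans _ _ (\sum_(z : {ffun 'I_n -> X1 * X2 * Y})
  (\prod_i PW (z i)) * (k * \sum_t (n%:R^-1 * \sum_i g t (z i)) ^+ 2))).
  rewrite big_ffun_triple; apply: ler_sum => a _; apply: ler_sum => b _.
  apply: ler_sum => c _; rewrite -big_split /=.
  rewrite [X in _ <= X * _](eq_bigr (fun i => P (a i) (b i) * W (a i) (b i) (c i)));
    last by move=> i _; rewrite ffunE.
  rewrite ler_wpM2l ?prodr_ge0 // => [i _|]; first exact: mulr_ge0.
  rewrite (eq_bigr (fun t => (jtype R a b c t - PW t) ^+ 2)) => [|t _]; last first.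
    congr (_ ^+ 2); rewrite /jtype card_letters sumrB sumr_const card_ord.
    rewrite mulrBr -[PW t *+ n]mulr_natl mulKf // mulrC; congr (_ / _ - _).
    by apply: eq_bigr => i _; rewrite ffunE.
  case: (leP d) => /= dtv; last by rewrite mulr_ge0 // sumr_ge0 // => t _; exact: sqr_ge0.
  (* Pigeonhole over the [N] letters; the constant [k] is the inverse square of this deviation. *)
  have [t ht] : exists t, 2 * d / N%:R <= `|jtype R a b c t - PW t|.
    apply/not_existsP => h; move: dtv; apply/negP; rewrite -ltNge /tv_to_PW.
    rewrite mulrC ltr_pdivrMr //.
    have -> : d * 2 = \sum_(t : X1 * X2 * Y) 2 * d / N%:R.
      rewrite sumr_const -/N -[RHS]mulr_natl [RHS]mulrC divfK 1?mulrC //.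
      by rewrite pnatr_eq0 -lt0n.
    have lt t : `|jtype R a b c t - PW t| < 2 * d / N%:R.
      by rewrite ltNge; apply/negP/h.
    apply: ltr_sum => //; move/card_gt0P : N0 => [t _].
    by apply/hasP; exists t; rewrite ?mem_index_enum.
  apply: (@le_trans _ _ (k * (jtype R a b c t - PW t) ^+ 2)); last first.
    rewrite ler_wpM2l // (bigD1 t) //= lerDl sumr_ge0 // => s _; exact: sqr_ge0.
  rewrite -[X in k * X]real_normK ?num_real // /k -exprMn exprn_ege1 //.
  move: ht; rewrite ler_pdivrMr ?ltr0n // => ht.
  by rewrite mulrAC ler_pdivlMr ?mulr_gt0 // mul1r [leRHS]mulrC.
rewrite le_eqVlt; apply/orP; left; apply/eqP.
transitivity (k * n%:R^-1 ^+ 2 * \sum_t \sum_(z : {ffun 'I_n -> X1 * X2 * Y})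
    (\prod_i PW (z i)) * (\sum_i g t (z i)) ^+ 2).
  rewrite exchange_big mulr_sumr; apply: eq_bigr => z _ /=.
  rewrite mulrCA -[RHS]mulrA; congr (_ * _); rewrite !mulr_sumr.
  by apply: eq_bigr => t _; rewrite exprMn mulrCA.
have E t : \sum_(z : {ffun 'I_n -> X1 * X2 * Y}) (\prod_i PW (z i)) *
    (\sum_i g t (z i)) ^+ 2 = n%:R * \sum_s PW s * g t s ^+ 2.
  apply: expect_sqr_sum_iid; first exact: sum_joint123.
  under eq_bigr do rewrite mulrBr.
  rewrite sumrB -mulr_suml sum_joint123 mul1r (bigD1 t) //= eqxx mulr1.
  by rewrite big1 ?addr0 ?subrr // => s /negPf ->; rewrite mulr0.
rewrite (eq_bigr _ (fun t _ => E t)) -mulr_sumr; field.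
exact: n0'.
Qed.
End Types.

(** * Information quantities *)

Section Information.
Variables (R : realType) (X1 X2 Y : finType).
Variables (P : X1 -> X2 -> R) (W : X1 -> X2 -> Y -> R).
Hypotheses (HP0 : forall x1 x2, 0 <= P x1 x2)
  (HP1 : \sum_(x1 : X1) \sum_(x2 : X2) P x1 x2 = 1)
  (HW0 : forall x1 x2 y, 0 <= W x1 x2 y)
  (HW1 : forall x1 x2, \sum_(y : Y) W x1 x2 y = 1).
Local Notation PW := (joint123 P W).

(* The fallback value makes this a probability law even where [marg2] vanishes. *)
Definition cond1 (x2 : X2) (x1 : X1) : R :=
  if marg2 P W x2 == 0 then \sum_x P x1 x else P x1 x2 / marg2 P W x2.

Definition condY (x2 : X2) (y : Y) : R := \sum_x1 cond1 x2 x1 * W x1 x2 y.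

Lemma marg2E x2 : marg2 P W x2 = \sum_x1 P x1 x2.
Proof. by apply: eq_bigr => x1 _; rewrite -mulr_sumr HW1 mulr1. Qed.

Lemma marg2_ge0 x2 : 0 <= marg2 P W x2.
Proof. by rewrite marg2E sumr_ge0. Qed.

Lemma sum_marg2 : \sum_x2 marg2 P W x2 = 1.
Proof. by rewrite -HP1 [RHS]exchange_big; apply: eq_bigr => x2 _; rewrite marg2E. Qed.

(** Where [marg2] vanishes, so does every [P x1 x2], hence the fallback value does no harm. *)
Lemma marg2_cond1 x1 x2 : marg2 P W x2 * cond1 x2 x1 = P x1 x2.
Proof.
rewrite /cond1; case: eqP => [m0|/eqP m0]; last by rewrite mulrC divfK.
rewrite m0 mul0r; apply/esym/eqP; move/eqP: m0.
by rewrite marg2E psumr_eq0 // => /allP/(_ x1 (mem_index_enum _)).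
Qed.

Lemma cond1_ge0 x2 x1 : 0 <= cond1 x2 x1.
Proof. by rewrite /cond1; case: eqP => _; rewrite ?sumr_ge0 ?divr_ge0 ?marg2_ge0. Qed.

Lemma sum_cond1 x2 : \sum_x1 cond1 x2 x1 = 1.
Proof.
rewrite /cond1; case: eqP => [_ //|/eqP m0].
by rewrite -mulr_suml -marg2E divff.
Qed.

Lemma condY_ge0 x2 y : 0 <= condY x2 y.
Proof. by apply: sumr_ge0 => x1 _; rewrite mulr_ge0 ?cond1_ge0. Qed.

Lemma sum_condY x2 : \sum_y condY x2 y = 1.
Proof.
rewrite exchange_big /= -(sum_cond1 x2); apply: eq_bigr => x1 _.
by rewrite -mulr_sumr HW1 mulr1.
Qed.

Lemma marg2_condY x2 y : marg2 P W x2 * condY x2 y = marg2Y P W (x2, y).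
Proof.
rewrite mulr_sumr; apply: eq_bigr => x1 _.
by rewrite mulrA marg2_cond1.
Qed.

Lemma margY_ge0 y : 0 <= margY P W y.
Proof. by rewrite !sumr_ge0 // => x1 _; rewrite sumr_ge0 // => x2 _; rewrite mulr_ge0. Qed.

Lemma sum_margY : \sum_y margY P W y = 1.
Proof.
rewrite -(sum_joint123 HP1 HW1) sum_triple exchange_big /=; apply: eq_bigr => x1 _.
by rewrite exchange_big.
Qed.

Lemma margY_gt0 x1 x2 y : 0 < PW (x1, x2, y) -> 0 < margY P W y.
Proof.
move=> p0; apply: lt_le_trans p0 _; rewrite /margY (bigD1 x1) //= (bigD1 x2) //=.
rewrite -addrA lerDl addr_ge0 // sumr_ge0 // => i _; first exact: mulr_ge0.
by rewrite sumr_ge0 // => j _; exact: mulr_ge0.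
Qed.

Lemma marg2Y_gt0 x1 x2 y : 0 < PW (x1, x2, y) -> 0 < marg2Y P W (x2, y).
Proof.
move=> p0; apply: lt_le_trans p0 _; rewrite /marg2Y (bigD1 x1) //= lerDl.
by rewrite sumr_ge0 // => i _; exact: mulr_ge0.
Qed.

Lemma condY_gt0 x1 x2 y : 0 < PW (x1, x2, y) -> 0 < condY x2 y.
Proof.
move=> /marg2Y_gt0; rewrite -marg2_condY => h.
rewrite lt_neqAle condY_ge0 andbT eq_sym; apply/eqP => h0.
by move: h; rewrite h0 mulr0 ltxx.
Qed.

Lemma ln2_gt0 : 0 < ln 2 :> R.
Proof. by rewrite ln_gt0 // ltr1n. Qed.

Lemma entropyE (T : finType) (p : T -> R) :
  ln 2 * entropy p = - \sum_t p t * ln (p t).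
Proof.
rewrite /entropy mulrN mulr_sumr; congr (- _); apply: eq_bigr => t _.
rewrite /xlog2x; case: eqP => [->|_]; first by rewrite !(mulr0, mul0r).
by rewrite mulrCA [ln 2 * _]mulrC divfK // gt_eqF // ln2_gt0.
Qed.

Lemma marg12E t : marg12 P W t = P t.1 t.2.
Proof. by rewrite /marg12 -mulr_sumr HW1 mulr1. Qed.

(** On the support of [PW], [ln W] is the logarithm of the joint mass minus that of [P]; this yields
    the conditional entropy given both inputs, whatever [V] is. *)
Lemma info_split (V : X2 -> Y -> R) :
  info P W V = - (ln 2 * condH_Y_X1X2 P W) - \sum_t PW t * ln (V t.1.2 t.2).
Proof.
rewrite /info; under eq_bigr do rewrite mulrBr.
rewrite sumrB; congr (_ - _).
rewrite /condH_Y_X1X2 mulrBr !entropyE opprK opprD opprK.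
have -> : \sum_t marg12 P W t * ln (marg12 P W t) = \sum_t PW t * ln (P t.1.1 t.1.2).
  rewrite sum_triple pair_bigA /=; apply: eq_bigr => t _.
  by rewrite marg12E -mulr_suml /joint123 /jointXY /= -mulr_sumr HW1 mulr1.
rewrite -sumrB; apply: eq_bigr => t _; rewrite -mulrBr.
have [p0|p0] := eqVneq (PW t) 0; first by rewrite p0 !mul0r.
congr (_ * _); move: p0; rewrite mulf_eq0 negb_or => /andP[a0 b0].
by rewrite lnM ?posrE ?lt_neqAle ?[0 == _]eq_sym ?a0 ?b0 //= addrC addKr.
Qed.

Lemma info_margY : info P W (fun=> margY P W) = ln 2 * mutinf_X1X2_Y P W.
Proof.
rewrite info_split /mutinf_X1X2_Y [RHS]mulrBr entropyE addrC; congr (- _ - _).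
rewrite sum_triple exchange_big /=.
under eq_bigr do rewrite exchange_big /=.
rewrite exchange_big /=; apply: eq_bigr => y _; rewrite exchange_big mulr_suml.
by apply: eq_bigr => x1 _; rewrite mulr_suml.
Qed.

(** On the support of [PW], [condY] is the quotient of [marg2Y] by [marg2]; the factor [ln 2]
    converts bits to nats. *)
Lemma info_condY : info P W condY = ln 2 * condmutinf_X1_Y_X2 P W.
Proof.
rewrite info_split /condmutinf_X1_Y_X2 [RHS]mulrBr addrC; congr (_ - _).
rewrite /condH_Y_X2 mulrBr !entropyE -opprD; congr (- _).
transitivity (\sum_t PW t * (ln (marg2Y P W (t.1.2, t.2)) - ln (marg2 P W t.1.2))).
  apply: eq_bigr => -[[x1 x2] y] _ /=.
  have [p0|p0] := eqVneq (PW (x1, x2, y)) 0; first by rewrite p0 !mul0r.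
  have {}p0 : 0 < PW (x1, x2, y) by rewrite lt_neqAle eq_sym p0 joint123_ge0.
  congr (_ * _); rewrite -marg2_condY lnM ?posrE ?(condY_gt0 p0) //; last first.
    move: (marg2Y_gt0 p0); rewrite -marg2_condY pmulr_lgt0 //.
    exact: condY_gt0 p0.
  by rewrite addrC addKr.
under eq_bigr do rewrite mulrBr.
rewrite sumrB; congr (_ - _); rewrite sum_triple exchange_big /=.
  under eq_bigr do rewrite exchange_big /=.
  rewrite pair_bigA /=; apply: eq_bigr => -[x2 y] _ /=.
  by rewrite mulr_suml.
apply: eq_bigr => x2 _; rewrite mulr_suml; apply: eq_bigr => x1 _.
by rewrite mulr_suml.
Qed.
End Information.

(** * Converse *)

Section MessageSize.
Variable R : realType.
Implicit Types (n : nat) (r : R).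

Lemma powR_rate_ge1 n r : 0 <= r -> 1 <= powR 2 (n%:R * r).
Proof. by move=> r0; rewrite -[X in X <= _](powRr0 2) ler_powR ?ler1n // mulr_ge0. Qed.

Lemma powR2_expR r : powR 2 r = expR (r * ln 2).
Proof. by rewrite /powR pnatr_eq0. Qed.

Lemma msize_gt0 n r : (0 < msize n r)%N.
Proof. by rewrite leq_max. Qed.

Lemma natr_floor (x : R) : 0 <= x -> `|Num.floor x|%N%:R <= x < `|Num.floor x|%N%:R + 1.
Proof.
move=> x0; have f0 : (0 <= Num.floor x)%R by rewrite floor_ge0.
rewrite -[X in X <= _](mulrz_nat) -[X in _ < X + 1]mulrz_nat.
by rewrite natz gez0_abs // floor_le_tmp -intrD1 floorD1_gt.
Qed.

Lemma msize_le n r : 0 <= r -> (msize n r)%:R <= powR 2 (n%:R * r).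
Proof.
move=> r0; have := powR_rate_ge1 n r0; rewrite /msize; move: (powR _ _) => x x1.
have /andP[fx _] := natr_floor (le_trans ler01 x1).
by rewrite /maxn; case: ifP.
Qed.

(** Rounding down loses less than 1, and the size is at least 1, so a factor 2 absorbs the loss. *)
Lemma msize_ge n r : powR 2 (n%:R * r) <= 2 * (msize n r)%:R.
Proof.
have := powR_ge0 2 (n%:R * r); rewrite /msize; move: (powR _ _) => x x0.
have /andP[_ fx] := natr_floor x0; apply: ltW; apply: lt_le_trans fx _.
rewrite mulr2n mulrDl mul1r lerD // ?ler_nat ?leq_maxr //.
by rewrite ler1n leq_maxl.
Qed.

End MessageSize.

Lemma sum_ord_le (R : realType) N (F : 'I_N -> R) (x : R) :
  (forall i, F i <= x) -> \sum_i F i <= N%:R * x.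
Proof.
move=> Fx; rewrite mulr_natl -[N in leRHS]card_ord -sumr_const.
exact: ler_sum.
Qed.

Section Converse.
Variables (R : realType) (X1 X2 Y : finType).
Variables (P : X1 -> X2 -> R) (W : X1 -> X2 -> Y -> R).
Hypotheses (HP0 : forall x1 x2, 0 <= P x1 x2)
  (HP1 : \sum_(x1 : X1) \sum_(x2 : X2) P x1 x2 = 1)
  (HW0 : forall x1 x2 y, 0 <= W x1 x2 y)
  (HW1 : forall x1 x2, \sum_(y : Y) W x1 x2 y = 1).
Local Notation PW := (joint123 P W).
Implicit Type V : X2 -> Y -> R.

Lemma Wn_ge0 n (a : {ffun 'I_n -> X1}) b c : 0 <= Wn W a b c.
Proof. exact: prodr_ge0. Qed.

Lemma sum_Wn n (a : {ffun 'I_n -> X1}) (b : {ffun 'I_n -> X2}) :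
  \sum_c Wn W a b c = 1.
Proof. by rewrite (sum_prod_law (p := fun i => W (a i) (b i))). Qed.

Lemma success_weight n M0 M1 M12 (C : Defs.code X1 X2 Y n M0 M1 M12) (d : R) :
  (0 < M0)%N -> (0 < M1)%N ->
  (M0 * M1)%:R * (1 - perr P W C d) =
  \sum_m0 \sum_m1 \sum_y
    Wn W (enc1 C m0 m1) (enc2 C m0 (conf C m0 m1)) y *
    ((dec C y == (m0, m1)) &&
     (tv_to_PW P W (enc1 C m0 m1) (enc2 C m0 (conf C m0 m1)) y < d)%R)%:R.
Proof.
move=> M00 M10; rewrite mulrBr mulr1 /perr mulVKf; last first.
  by rewrite pnatr_eq0 muln_eq0 negb_or -!lt0n M00.
have -> : (M0 * M1)%:R = \sum_(m0 < M0) \sum_(m1 < M1)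
    \sum_y Wn W (enc1 C m0 m1) (enc2 C m0 (conf C m0 m1)) y.
  rewrite (eq_bigr (fun=> M1%:R)) => [|m0 _].
    by rewrite sumr_const card_ord natrM mulr_natl.
  rewrite (eq_bigr (fun=> 1)) => [|m1 _]; last exact: sum_Wn.
  by rewrite sumr_const card_ord.
rewrite -sumrB; apply: eq_bigr => m0 _; rewrite -sumrB; apply: eq_bigr => m1 _.
rewrite -sumrB; apply: eq_bigr => y _ /=.
rewrite -[X in X - _]mulr1 -mulrBr; congr (_ * _).
case: eqP => _ /=; last by rewrite subrr.
by rewrite ltNge; case: (_ <= _) => /=; rewrite ?subrr ?subr0.
Qed.

Lemma subr_perr_ge0 n M0 M1 M12 (C : Defs.code X1 X2 Y n M0 M1 M12) (d : R) :
  (0 < M0)%N -> (0 < M1)%N -> 0 <= 1 - perr P W C d.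
Proof.
move=> M00 M10; have M01 : 0 < (M0 * M1)%:R :> R by rewrite ltr0n muln_gt0 M00.
rewrite -(pmulr_rge0 _ M01) success_weight //.
by do 3!(apply: sumr_ge0 => ? _); rewrite mulr_ge0 ?Wn_ge0.
Qed.

Lemma Vn_ge0 V n (b : {ffun 'I_n -> X2}) (c : {ffun 'I_n -> Y}) :
  (forall x2 y, 0 <= V x2 y) -> 0 <= Vn V b c :> R.
Proof. by move=> V0; exact: prodr_ge0. Qed.

Lemma sum_Vn V n (b : {ffun 'I_n -> X2}) : (forall x2, \sum_y V x2 y = 1) ->
  \sum_(c : {ffun 'I_n -> Y}) Vn V b c = 1 :> R.
Proof. by move=> V1; rewrite (sum_prod_law (p := fun i => V (b i))). Qed.

(** * Success bounds at a fixed block length *)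

Section OneShot.
Variables (n M0 M1 M12 : nat) (C : Defs.code X1 X2 Y n M0 M1 M12) (d g : R).
Hypotheses (M00 : (0 < M0)%N) (M10 : (0 < M1)%N) (g0 : 0 <= g).

(** Summing over all conference values [k] frees the X2 word from [m1]. For fixed [m0] and [k], the
    decoding sets of the various [m1] are disjoint and share one unit of mass, which leaves
    [M0 * M12] units. *)
Lemma success_le_conference (V : X2 -> Y -> R) : (forall x2 y, 0 <= V x2 y) ->
  (forall x2, \sum_y V x2 y = 1) ->
  (forall (a : {ffun 'I_n -> X1}) b c, tv_to_PW P W a b c < d ->
    Wn W a b c <= g * Vn V b c) ->
  (M0 * M1)%:R * (1 - perr P W C d) <= (M0 * M12)%:R * g.
Proof.
move=> V0 V1 h; rewrite success_weight //.
apply: (@le_trans _ _ (\sum_(m0 < M0) \sum_(k < M12) \sum_y \sum_(m1 < M1)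
    (dec C y == (m0, m1))%:R * (g * Vn V (enc2 C m0 k) y))).
  apply: ler_sum => m0 _; rewrite exchange_big [leRHS]exchange_big /=.
  apply: ler_sum => y _; rewrite exchange_big; apply: ler_sum => m1 _ /=.
  have term0 k : 0 <= (dec C y == (m0, m1))%:R * (g * Vn V (enc2 C m0 k) y).
    by rewrite !mulr_ge0 // Vn_ge0.
  rewrite (bigD1 (conf C m0 m1)) //=; apply: ler_wpDr; first exact: sumr_ge0.
  case: eqP => _ /=; last by rewrite mulr0 mul0r.
  rewrite mul1r; case: ltP => [tvd|_]; first by rewrite mulr1 h.
  by rewrite mulr0 mulr_ge0 // Vn_ge0.
rewrite natrM -mulrA; apply: sum_ord_le => m0; apply: sum_ord_le => k.
rewrite -[leRHS]mulr1 -[X in _ <= _ * X](sum_Vn (enc2 C m0 k) V1) mulr_sumr.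
apply: ler_sum => y _; rewrite -mulr_suml ler_piMl ?mulr_ge0 ?Vn_ge0 //.
case: (dec C y) => i j; rewrite (bigD1 j) //= [X in _ + X]big1 ?addr0.
  by rewrite lern1 leq_b1.
by move=> j' j'j; rewrite xpair_eqE [j == _]eq_sym (negPf j'j) andbF.
Qed.

(** The reference law depends on no codeword, so the decoding sets of all message pairs share a
    single unit of mass. *)
Lemma success_le_joint (Q : Y -> R) : (forall y, 0 <= Q y) -> \sum_y Q y = 1 ->
  (forall (a : {ffun 'I_n -> X1}) b c, tv_to_PW P W a b c < d ->
    Wn W a b c <= g * Vn (fun=> Q) b c) ->
  (M0 * M1)%:R * (1 - perr P W C d) <= g.
Proof.
move=> Q0 Q1 h; rewrite success_weight //.
have S1 := sum_prod_law (p := fun _ : 'I_n => Q) (fun=> Q1).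
rewrite -[leRHS]mulr1 -[X in _ <= _ * X]S1 mulr_sumr pair_bigA exchange_big /=.
apply: ler_sum => y _; rewrite (bigD1 (dec C y)) //= big1 ?addr0; last first.
  by move=> m mm; rewrite -surjective_pairing eq_sym (negPf mm) mulr0.
rewrite -surjective_pairing eqxx /=; case: ltP => [tvd|_].
  by rewrite mulr1 h.
by rewrite mulr0 mulr_ge0 // prodr_ge0.
Qed.

End OneShot.

(** Mixture with the uniform law: positive everywhere for [e > 0], and at least [expR (- e) * V], so
    the density grows by at most [e] where [V] is positive. *)
Definition smooth (e : R) (V : X2 -> Y -> R) x2 y : R :=
  expR (- e) * V x2 y + (1 - expR (- e)) / #|Y|%:R.

Lemma outputs_gt0 : (0 < #|Y|)%N.
Proof.
rewrite lt0n; apply/negP => /eqP/card0_eq h.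
have : \sum_y margY P W y = 0 by apply: big1 => y; have := h y; rewrite inE.
by rewrite sum_margY // => /eqP; rewrite oner_eq0.
Qed.

Lemma smooth_gt0 e V x2 y : 0 < e -> (forall x2 y, 0 <= V x2 y) ->
  0 < smooth e V x2 y.
Proof.
move=> e0 V0; rewrite ltr_wpDl ?mulr_ge0 ?expR_ge0 // divr_gt0 ?ltr0n ?outputs_gt0 //.
by rewrite subr_gt0 expR_lt1 oppr_lt0.
Qed.

Lemma sum_smooth e V x2 : \sum_y V x2 y = 1 -> \sum_y smooth e V x2 y = 1.
Proof.
move=> V1; rewrite big_split /= -mulr_sumr V1 sumr_const -[X in _ + X]mulr_natl.
by rewrite [X in _ + X]mulrC divfK ?mulr1 1?addrC ?subrK // pnatr_eq0 -lt0n outputs_gt0.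
Qed.

Lemma info_smooth e V : 0 < e -> (forall x2 y, 0 <= V x2 y) ->
  (forall x1 x2 y, 0 < PW (x1, x2, y) -> 0 < V x2 y) ->
  info P W (smooth e V) <= info P W V + e.
Proof.
move=> e0 V0 Vp; rewrite -[e in leRHS]mul1r -(sum_joint123 HP1 HW1) mulr_suml.
rewrite /info -big_split; apply: ler_sum => -[[x1 x2] y] _ /=; rewrite -mulrDr.
have [->|p0] := eqVneq (PW (x1, x2, y)) 0; first by rewrite !mul0r.
have {}p0 : 0 < PW (x1, x2, y) by rewrite lt_neqAle eq_sym p0 joint123_ge0.
rewrite ler_pM2l // /logratio /=.
have Vp2 := Vp _ _ _ p0.
suff : ln (V x2 y) - e <= ln (smooth e V x2 y) by lra.
rewrite -[- e]expRK addrC -lnM ?posrE ?expR_gt0 //.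
rewrite ler_ln ?posrE ?smooth_gt0 ?mulr_gt0 ?expR_gt0 // lerDl.
by rewrite divr_ge0 // subr_ge0 -expR0 ler_expR oppr_le0 ltW.
Qed.
End Converse.

(** If [x] exceeded [J], one large [n] with [p n < 1/2] would contradict the bound:
    [expR (n * (x - J))] passes [2 * K] by the inequality [1 + y <= expR y]. *)
Lemma exponent_le (R : realType) (x J K : R) (p : nat -> R) :
  p n @[n --> \oo] --> 0 ->
  (forall n, (0 < n)%N ->
    expR (n%:R * x) * (1 - p n) <= K * expR (n%:R * J)) ->
  x <= J.
Proof.
move=> p0 h; rewrite leNgt; apply/negP => Jx.
have k0 : 0 < x - J by rewrite subr_gt0.
have half0 : 0 < 2^-1 :> R by rewrite invr_gt0.
have [N _ HN] : \forall n \near \oo,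
    [/\ `|p n| < 2^-1, (2 * K) / (x - J) < n%:R :> R & (0 < n)%N].
  near=> n; split; near: n.
  - by move/cvgr0_norm_lt : p0; apply.
  - exact: nbhs_infty_gtr.
  - exact: nbhs_infty_gt.
have [pN KN N0] := HN N (leqnn N); have := h N N0.
have -> : N%:R * x = N%:R * (x - J) + N%:R * J by ring.
rewrite expRD mulrAC ler_pM2r ?expR_gt0 //.
move: KN; rewrite ltr_pdivrMr //.
move: (N%:R * (x - J)) => y yK; have := expR_ge1Dx y; have := expR_gt0 y.
move: (ltr_normlW pN); move: (expR y) (p N) => e q; nra.
Unshelve. all: by end_near. Qed.

Section ConverseBound.
Variables (R : realType) (X1 X2 Y : finType).
Variables (P : X1 -> X2 -> R) (W : X1 -> X2 -> Y -> R).
Hypotheses (HP0 : forall x1 x2, 0 <= P x1 x2)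
  (HP1 : \sum_(x1 : X1) \sum_(x2 : X2) P x1 x2 = 1)
  (HW0 : forall x1 x2 y, 0 <= W x1 x2 y)
  (HW1 : forall x1 x2, \sum_(y : Y) W x1 x2 y = 1).
Local Notation PW := (joint123 P W).
Implicit Type V : X2 -> Y -> R.

Lemma Wn_le_smooth V (e : R) : 0 < e -> (forall x2 y, 0 <= V x2 y) ->
  (forall x1 x2 y, 0 < PW (x1, x2, y) -> 0 < V x2 y) ->
  exists2 d : R, 0 < d &
  forall n (a : {ffun 'I_n -> X1}) b c, (0 < n)%N -> tv_to_PW P W a b c < d ->
    Wn W a b c <= expR (n%:R * (info P W V + e)) * Vn (smooth (e / 2) V) b c.
Proof.
(* One half of [e] pays for typicality, the other for smoothing. *)
move=> e0 V0 Vp; have e20 : 0 < e / 2 by rewrite divr_gt0.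
have s0 x2 y : 0 < smooth (e / 2) V x2 y by exact: (smooth_gt0 HP1 HW1).
have [d d0 hd] := Wn_typical P HW0 (fun x2 y => ltW (s0 x2 y)) e20.
exists d => // n a b c n0 tvd.
have Vs0 : 0 < Vn (smooth (e / 2) V) b c by exact: prodr_gt0.
have := Wn_ge0 HW0 a b c; rewrite le_eqVlt => /predU1P[<-|Wp].
  by rewrite mulr_ge0 ?expR_ge0 // ltW.
have /andP[_ le] := hd n a b c n0 tvd Wp Vs0; apply: le_trans le _.
rewrite ler_pM2r // ler_expR ler_pM2l ?ltr0n // [e in leRHS]splitr addrA lerD2r.
exact: (info_smooth HP0 HP1 HW0 HW1).
Qed.

Section Rates.
Variables (R12 : R) (r : R * R).
Hypotheses (HR12 : 0 <= R12) (ach : achievable P W R12 r).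

Lemma achievable_joint (e : R) : 0 < e ->
  (r.1 + r.2) * ln 2 <= info P W (fun=> margY P W) + e.
Proof.
move=> e0; have [r10 [r20 /=]] := ach.
have Q0 x2 y : 0 <= (fun _ : X2 => margY P W) x2 y by exact: margY_ge0.
have [d d0 hd] := Wn_le_smooth e0 Q0 (margY_gt0 HP0 HW0).
(* The constant 4 is a rounding factor 2 for each of the two message sets. *)
move=> /(_ d d0)[C Cp]; apply: (exponent_le (K := 4) Cp) => n n0.
pose Q := smooth (e / 2) (fun _ : X2 => margY P W).
have e20 : 0 < e / 2 by rewrite divr_gt0.
(* [smooth] expects an input letter even for a law constant in it; one exists because [P] has mass
   1. *)
have [x2 _] : exists x2 : X2, True.
  apply/not_existsP => noX2; have := HP1; rewrite exchange_big big1.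
    by move/eqP; rewrite eq_sym oner_eq0.
  by move=> x2; case: (noX2 x2).
have := @success_le_joint _ _ _ _ P W HW1 _ _ _ _ (C n) d
  (expR (n%:R * (info P W (fun=> margY P W) + e)))
  (msize_gt0 _ _) (msize_gt0 _ _) (expR_ge0 _) (Q x2)
  (fun y => ltW (smooth_gt0 HP1 HW1 x2 y e20 Q0))
  (sum_smooth HP1 HW1 _ (sum_margY HP1 HW1)) (fun a b c => hd n a b c n0).
rewrite natrM => h; apply: (@le_trans _ _
  (4 * ((msize n r.1)%:R * (msize n r.2)%:R) * (1 - perr P W (C n) d))).
  2: by rewrite -mulrA ler_pM2l.
rewrite ler_wpM2r ?subr_perr_ge0 ?msize_gt0 //.
have -> : n%:R * ((r.1 + r.2) * ln 2) = n%:R * r.1 * ln 2 + n%:R * r.2 * ln 2 by ring.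
rewrite expRD -!powR2_expR.
have -> : 4 = 2 * 2 :> R by ring.
by rewrite mulrACA ler_pM ?powR_ge0 ?msize_ge.
Qed.

Lemma achievable_conference V (e : R) :
  0 < e -> (forall x2 y, 0 <= V x2 y) -> (forall x2, \sum_y V x2 y = 1) ->
  (forall x1 x2 y, 0 < PW (x1, x2, y) -> 0 < V x2 y) ->
  r.2 * ln 2 <= R12 * ln 2 + (info P W V + e).
Proof.
move=> e0 V0 V1 Vp; have [r10 [r20 /=]] := ach.
have [d d0 hd] := Wn_le_smooth e0 V0 Vp.
move=> /(_ d d0)[C Cp].
(* Only the private message set is bounded from below: the common one cancels and the conference one
   is bounded from above. *)
apply: (exponent_le (K := 2) Cp) => n n0; have e20 : 0 < e / 2 by rewrite divr_gt0.
have := @success_le_conference _ _ _ _ P W HW1 _ _ _ _ (C n) d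
  (expR (n%:R * (info P W V + e))) (msize_gt0 _ _) (msize_gt0 _ _) (expR_ge0 _)
  (smooth (e / 2) V) (fun x2 y => ltW (smooth_gt0 HP1 HW1 x2 y e20 V0))
  (fun x2 => sum_smooth HP1 HW1 _ (V1 x2)) (fun a b c => hd n a b c n0).
rewrite !natrM -!mulrA ler_pM2l ?ltr0n ?msize_gt0 // => h.
apply: (@le_trans _ _ (2 * ((msize n r.2)%:R * (1 - perr P W (C n) d)))).
  rewrite [leRHS]mulrA ler_wpM2r ?subr_perr_ge0 ?msize_gt0 //.
  by rewrite mulrA -powR2_expR msize_ge.
rewrite ler_pM2l //; apply: le_trans h _.
rewrite [X in _ <= expR X]mulrDr expRD ler_wpM2r ?expR_ge0 //.
by rewrite mulrA -powR2_expR msize_le.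
Qed.
End Rates.

Lemma achievable_region R12 : 0 <= R12 -> achievable P W R12 `<=`
  [set r : R * R | [/\ 0 <= r.1, 0 <= r.2, r.1 + r.2 <= mutinf_X1X2_Y P W &
      r.2 <= condmutinf_X1_Y_X2 P W + R12]].
Proof.
move=> HR12 r ach; have [r10 [r20 _]] := ach; split => //.
  rewrite -(ler_pM2r (ln2_gt0 R)); apply/ler_addgt0Pr => e e0.
  by rewrite [_ * ln 2 in leRHS]mulrC -info_margY //; exact: achievable_joint ach _ e0.
rewrite -(ler_pM2r (ln2_gt0 R)); apply/ler_addgt0Pr => e e0.
rewrite [_ * ln 2 in leRHS]mulrDl [X in X + _ + _]mulrC -info_condY // [X in X + _]addrC -addrA.
apply: (achievable_conference HR12 ach e0).
- exact: condY_ge0.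
- exact: sum_condY.
- exact: condY_gt0.
Qed.
End ConverseBound.

(** * Achievability *)

(** Within a residue class an index is determined by its quotient, and [j] itself is removed. The
    bound is 0 for [M = 1], as needed at zero private rate. *)
Lemma card_congruent M M12 (j : 'I_M) :
  (#|[pred j' : 'I_M | (j' != j) && (j' %% M12 == j %% M12)]| <= M.-1 %/ M12)%N.
Proof.
pose A := [pred j' : 'I_M | j' %% M12 == j %% M12]%N.
have -> : #|[pred j' : 'I_M | (j' != j) && (j' %% M12 == j %% M12)%N]| = #|A|.-1.
  by rewrite (cardD1 j A) inE eqxx add1n; apply: eq_card => i; rewrite !inE.
have lt (i : 'I_M) : (i %/ M12 < (M.-1 %/ M12).+1)%N.
  by rewrite ltnS leq_div2r // -ltnS prednK // (leq_ltn_trans _ (ltn_ord i)).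
have inj : {in A &, injective (fun i => Ordinal (lt i))}.
  move=> i k; rewrite !inE => /eqP ij /eqP kj [] ik; apply: val_inj => /=.
  by rewrite (divn_eq i M12) (divn_eq k M12) ik ij kj.
rewrite -subn1 leq_subLR add1n -(card_in_image inj).
by rewrite -[leqRHS]card_ord max_card.
Qed.

Section RandomCoding.
Variables (R : realType) (X1 X2 Y : finType).
Variables (P : X1 -> X2 -> R) (W : X1 -> X2 -> Y -> R).
Hypotheses (HP0 : forall x1 x2, 0 <= P x1 x2)
  (HP1 : \sum_(x1 : X1) \sum_(x2 : X2) P x1 x2 = 1)
  (HW0 : forall x1 x2 y, 0 <= W x1 x2 y)
  (HW1 : forall x1 x2, \sum_(y : Y) W x1 x2 y = 1).
Local Notation PW := (joint123 P W).

Section RandomCode.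
Variables (n : nat).
Local Notation A := {ffun 'I_n -> X1}.
Local Notation B := {ffun 'I_n -> X2}.
Local Notation Z := {ffun 'I_n -> Y}.

Definition center_law (b : B) : R := \prod_i marg2 P W (b i).
Definition satellite_law (b : B) (a : A) : R := \prod_i cond1 P W (b i) (a i).

Lemma center_law_ge0 b : 0 <= center_law b.
Proof. by apply: prodr_ge0 => i _; exact: marg2_ge0. Qed.

Lemma sum_center_law : \sum_b center_law b = 1.
Proof. by rewrite (sum_prod_law (p := fun=> marg2 P W)) // => _; exact: sum_marg2. Qed.

Lemma satellite_law_ge0 b a : 0 <= satellite_law b a.
Proof. by apply: prodr_ge0 => i _; exact: cond1_ge0. Qed.

Lemma sum_satellite_law b : \sum_a satellite_law b a = 1.
Proof.
by rewrite (sum_prod_law (p := fun i => cond1 P W (b i))) // => i; exact: sum_cond1.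
Qed.

Lemma cond_out_Wn b z : cond_out satellite_law (@Wn _ _ _ _ W n) b z = Vn (condY P W) b z.
Proof.
rewrite /cond_out /Vn /condY bigA_distr_bigA; apply: eq_bigr => a _.
by rewrite -big_split.
Qed.

(** Averaging a memoryless channel over letterwise product inputs factorises; [b] is arbitrary since
    the law on the right is constant in it. *)
Lemma out_Wn b z : out center_law satellite_law (@Wn _ _ _ _ W n) z = Vn (fun _ : X2 => margY P W) b z.
Proof.
transitivity (\sum_(b' : B) \prod_i (marg2 P W (b' i) * condY P W (b' i) (z i))).
  by apply: eq_bigr => b' _; rewrite big_split /= -[RHS]/(center_law b' * Vn (condY P W) b' z) -cond_out_Wn.
rewrite -(bigA_distr_bigA (fun i x2 => marg2 P W x2 * condY P W x2 (z i))).
apply: eq_bigr => i _; rewrite /margY exchange_big; apply: eq_bigr => x2 _.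
exact: marg2_condY.
Qed.

Lemma joint_expect_Pn (f : A -> B -> R) :
  joint_expect center_law satellite_law f = \sum_a \sum_b Pn P a b * f a b.
Proof.
rewrite exchange_big; apply: eq_bigr => b _; rewrite mulr_sumr.
apply: eq_bigr => a _; rewrite mulrA -big_split; congr (_ * _).
by apply: eq_bigr => i _ /=; rewrite marg2_cond1.
Qed.

(** The decoding test. The density thresholds are written multiplicatively, so that no division or
    logarithm of 0 occurs. *)
Definition good (d g1 g2 : R) (a : A) (b : B) (c : Z) : bool :=
  [&& tv_to_PW P W a b c < d, g1 * Vn (fun _ : X2 => margY P W) b c <= Wn W a b c
    & g2 * Vn (condY P W) b c <= Wn W a b c].

Lemma random_code M0 M1 M12 (delta d g1 g2 : R) :
  (0 < M0)%N -> (0 < M1)%N -> (0 < M12)%N -> d <= delta -> 0 < g1 -> 0 < g2 ->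
  exists C : Defs.code X1 X2 Y n M0 M1 M12, perr P W C delta <=
    \sum_a \sum_b \sum_c Pn P a b * Wn W a b c * (~~ good d g1 g2 a b c)%:R +
    (M0 * M1).-1%:R / g1 + (M1.-1 %/ M12)%:R / g2.
Proof.
move=> M00 M10 M120 ddelta g10 g20.
pose cf (j : 'I_M1) : 'I_M12 := Ordinal (ltn_pmod j M120).
have [x1 [x2 [dec Hdec]]] := superposition_coding (good d g1 g2) center_law_ge0 sum_center_law
  satellite_law_ge0 sum_satellite_law (@Wn_ge0 _ _ _ _ _ HW0 n) (Ordinal M00, Ordinal M10)
  (fun j : 'I_M1 => card_congruent M12 j : (#|[pred j' | (j' != j) && (cf j' == cf j)]| <= _)%N).
exists (Code (fun=> cf) x1 x2 dec).
rewrite /perr /= pair_bigA /= ler_pdivrMl ?ltr0n ?muln_gt0 ?M00 //.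
(* Since [d <= delta], a type at distance at least [delta] already fails the test. *)
apply: le_trans (le_trans Hdec _).
  apply: ler_sum => -[m0 m1] _ /=; apply: ler_sum => y _.
  rewrite ler_wpM2l ?Wn_ge0 //; case: eqP => _ /=; last exact: lexx.
  case: (leP delta) => [dtv|_]; last by rewrite ler0n.
  by rewrite /good ltNge (le_trans ddelta dtv).
rewrite card_prod !card_ord ler_wpM2l // -!addrA lerD //.
  rewrite joint_expect_Pn; apply: ler_sum => a _; apply: ler_sum => b _.
  by rewrite mulr_sumr; apply: ler_sum => c _; rewrite mulrA.
rewrite lerD // ler_wpM2l //.
(* Markov's inequality by change of measure: on passing outputs the reference law is at most
   [Wn / g1], and [Wn] sums to 1. The next case is the same with [g2]. *)
- rewrite -[leRHS](joint_expect_cst sum_center_law sum_satellite_law).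
  apply: (ler_joint_expect center_law_ge0 satellite_law_ge0) => a b.
  rewrite -[leRHS]mulr1 -[X in _ <= _ * X](sum_Wn HW1 a b) mulr_sumr; apply: ler_sum => z _.
  rewrite (out_Wn b) ler_pdivlMl //; case: (boolP (good _ _ _ _ _ _)) => [/and3P[_ + _]|_].
    by rewrite mulr1.
  by rewrite !mulr0 Wn_ge0.
- rewrite -[leRHS](joint_expect_cst sum_center_law sum_satellite_law).
  apply: (ler_joint_expect center_law_ge0 satellite_law_ge0) => a b.
  rewrite -[leRHS]mulr1 -[X in _ <= _ * X](sum_Wn HW1 a b) mulr_sumr; apply: ler_sum => z _.
  rewrite cond_out_Wn ler_pdivlMl //; case: (boolP (good _ _ _ _ _ _)) => [/and3P[_ _ +]|_].
    by rewrite mulr1.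
  by rewrite !mulr0 Wn_ge0.
Qed.

End RandomCode.
End RandomCoding.

(** * Decay of the two confusion terms *)

Section Counting.
Variable R : realType.

(** Exponential decay is weakened to order [1 / n], the rate available for atypical types, so that
    all error terms add up. *)
Lemma expR_ratio_le (x g : R) n : x < g -> (0 < n)%N ->
  expR (n%:R * x) / expR (n%:R * g) <= (g - x)^-1 / n%:R.
Proof.
move=> xg n0; have ng : 0 < (g - x) * n%:R by rewrite mulr_gt0 ?ltr0n ?subr_gt0.
rewrite -expRB -mulrBr -opprB mulrN expRN -invfM mulrC lef_pV2 ?posrE ?expR_gt0 //.
by apply: le_trans (expR_ge1Dx _); rewrite lerDr.
Qed.

Lemma msize0 n : msize n (0 : R) = 1%N.
Proof.
apply/eqP; rewrite eqn_leq msize_gt0 andbT -(ler_nat R).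
by apply: le_trans (msize_le _ (lexx _)) _; rewrite mulr0 powRr0.
Qed.

(** At zero total rate there is a single message pair and no competitor, so no condition on [g] is
    needed. *)
Lemma joint_confusion_rate (s : R * R) (g : R) : 0 <= s.1 -> 0 <= s.2 ->
  (s.1 + s.2) * ln 2 < g \/ s.1 + s.2 = 0 ->
  exists K : R, forall n, (0 < n)%N ->
    (msize n s.1 * msize n s.2).-1%:R / expR (n%:R * g) <= K / n%:R.
Proof.
move=> s10 s20 [sg|/eqP].
  exists (g - (s.1 + s.2) * ln 2)^-1 => n n0.
  apply: le_trans (expR_ratio_le sg n0); rewrite ler_pM2r ?invr_gt0 ?expR_gt0 //.
  apply: (@le_trans _ _ ((msize n s.1)%:R * (msize n s.2)%:R)).
    by rewrite -natrM ler_nat leq_pred.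
  have -> : n%:R * ((s.1 + s.2) * ln 2) = n%:R * s.1 * ln 2 + n%:R * s.2 * ln 2 by ring.
  by rewrite expRD -!powR2_expR ler_pM ?ler0n ?msize_le.
rewrite paddr_eq0 // => /andP[/eqP -> /eqP ->]; exists 0 => n _.
by rewrite !msize0 !mul0r.
Qed.

Lemma conference_confusion_rate (s R12 g : R) : 0 <= s ->
  s * ln 2 < g + R12 * ln 2 \/ s = 0 ->
  exists K : R, forall n, (0 < n)%N ->
    ((msize n s).-1 %/ msize n R12)%:R / expR (n%:R * g) <= K / n%:R.
Proof.
move=> s0 [sg|->]; last first.
  by exists 0 => n _; rewrite msize0 div0n !mul0r.
have {}sg : s * ln 2 - R12 * ln 2 < g by lra.
(* The factor 2 comes from rounding the conference set, which stands in the denominator. *)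
exists (2 * (g - (s * ln 2 - R12 * ln 2))^-1) => n n0.
apply: (@le_trans _ _ (2 * (expR (n%:R * (s * ln 2 - R12 * ln 2)) / expR (n%:R * g)))).
  2: by rewrite -[leRHS]mulrA ler_pM2l // expR_ratio_le.
rewrite mulrA ler_pM2r ?invr_gt0 ?expR_gt0 //.
rewrite mulrBr expRB !mulrA -!powR2_expR ler_pdivlMr ?powR_gt0 //.
apply: (@le_trans _ _ (((msize n s).-1 %/ msize n R12)%:R * (2 * (msize n R12)%:R))).
  by rewrite ler_wpM2l ?msize_ge.
rewrite mulrCA ler_pM2l // -natrM; apply: le_trans (msize_le n s0).
by rewrite ler_nat (leq_trans (leq_trunc_div _ _)) ?leq_pred.
Qed.

End Counting.

Section Achievability.
Variables (R : realType) (X1 X2 Y : finType).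
Variables (P : X1 -> X2 -> R) (W : X1 -> X2 -> Y -> R).
Hypotheses (HP0 : forall x1 x2, 0 <= P x1 x2)
  (HP1 : \sum_(x1 : X1) \sum_(x2 : X2) P x1 x2 = 1)
  (HW0 : forall x1 x2 y, 0 <= W x1 x2 y)
  (HW1 : forall x1 x2, \sum_(y : Y) W x1 x2 y = 1).
Local Notation PW := (joint123 P W).
Implicit Type V : X2 -> Y -> R.

(** A triple of positive probability has every letter in the support of [PW], where [V] is positive;
    typicality then applies with slack [info P W V - g]. *)
Lemma typical_ratio V (g : R) : (forall x2 y, 0 <= V x2 y) ->
  (forall x1 x2 y, 0 < PW (x1, x2, y) -> 0 < V x2 y) -> g < info P W V ->
  exists2 d : R, 0 < d &
  forall n (a : {ffun 'I_n -> X1}) b c, (0 < n)%N -> tv_to_PW P W a b c < d ->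
    Pn P a b * Wn W a b c != 0 -> expR (n%:R * g) * Vn V b c <= Wn W a b c.
Proof.
move=> V0 Vp gV; have e0 : 0 < info P W V - g by rewrite subr_gt0.
have [d d0 hd] := Wn_typical P HW0 V0 e0; exists d => // n a b c n0 tvd nz.
have Vgt0 : 0 < Vn V b c.
  apply: prodr_gt0 => i _; apply: (Vp (a i)).
  move: nz; rewrite -big_split /= => /prodf_neq0/(_ i isT) nz.
  by rewrite lt_neqAle eq_sym nz joint123_ge0.
have Wgt0 : 0 < Wn W a b c.
  move: nz; rewrite mulf_eq0 negb_or => /andP[_ nz].
  by rewrite lt_neqAle eq_sym nz Wn_ge0.
by have /andP[+ _] := hd n a b c n0 tvd Wgt0 Vgt0; rewrite subKr.
Qed.

(** For [d] small enough, a typical triple of positive probability passes both density tests, so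
    only atypical types remain. *)
Lemma bad_prob (delta g1 g2 : R) : 0 < delta ->
  g1 < info P W (fun=> margY P W) -> g2 < info P W (condY P W) ->
  exists d K : R, d <= delta /\ forall n, (0 < n)%N ->
    \sum_(a : {ffun 'I_n -> X1}) \sum_(b : {ffun 'I_n -> X2})
      \sum_(c : {ffun 'I_n -> Y}) Pn P a b * Wn W a b c *
      (~~ good P W d (expR (n%:R * g1)) (expR (n%:R * g2)) a b c)%:R <= K / n%:R.
Proof.
move=> delta0 hg1 hg2.
have [d1 d10 hd1] := typical_ratio (fun _ y => margY_ge0 HP0 HW0 y) (margY_gt0 HP0 HW0) hg1.
have [d2 d20 hd2] := typical_ratio (condY_ge0 HP0 HW0 HW1) (condY_gt0 HP0 HW0 HW1) hg2.
pose d := Num.min delta (Num.min d1 d2).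
have [dd dd1 dd2] : [/\ d <= delta, d <= d1 & d <= d2].
  by split; rewrite /d !ge_min lexx ?orbT.
have d0 : 0 < d by rewrite !lt_min delta0 d10.
have [K K0 hK] := atypical_prob HP0 HP1 HW0 HW1 d0.
exists d, K; split => // n n0; apply: le_trans (hK n n0).
apply: ler_sum => a _; apply: ler_sum => b _; apply: ler_sum => c _.
have [->|nz] := eqVneq (Pn P a b * Wn W a b c) 0; first by rewrite !mul0r.
rewrite ler_wpM2l ?mulr_ge0 ?Wn_ge0 ?prodr_ge0 // ler_nat /good.
case: (ltP _ d) => //= tvd.
by rewrite hd1 ?hd2 // (lt_le_trans tvd).
Qed.

Lemma perr_ge0 n M0 M1 M12 (C : Defs.code X1 X2 Y n M0 M1 M12) (d : R) :
  0 <= perr P W C d.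
Proof.
rewrite mulr_ge0 ?invr_ge0 //; do 3!(apply: sumr_ge0 => ? _).
by rewrite mulr_ge0 ?Wn_ge0 //; case: ifP.
Qed.

(** The zero alternatives cover boundary cases such as a vanishing mutual information, where no
    strict inequality is possible. *)
Lemma achievable_interior (R12 : R) (s : R * R) : 0 <= s.1 -> 0 <= s.2 ->
  s.1 + s.2 < mutinf_X1X2_Y P W \/ s.1 + s.2 = 0 ->
  s.2 < condmutinf_X1_Y_X2 P W + R12 \/ s.2 = 0 ->
  achievable P W R12 s.
Proof.
move=> s10 s20 h1 h2; split=> //; split=> // delta delta0.
have [g1 g1I hg1] : exists2 g1, g1 < info P W (fun=> margY P W) &
    (s.1 + s.2) * ln 2 < g1 \/ s.1 + s.2 = 0.
  case: h1 => [sI|->]; last by exists (info P W (fun=> margY P W) - 1); [lra|right].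
  have : (s.1 + s.2) * ln 2 < info P W (fun=> margY P W).
    by rewrite info_margY // mulrC ltr_pM2l ?ln2_gt0.
  (* The threshold is the midpoint between the rate and the information, both in nats. *)
  by move: (info _ _ _) => I sI'; exists ((I + (s.1 + s.2) * ln 2) / 2); [lra|left; lra].
have [g2 g2I hg2] : exists2 g2, g2 < info P W (condY P W) &
    s.2 * ln 2 < g2 + R12 * ln 2 \/ s.2 = 0.
  case: h2 => [sI|->]; last by exists (info P W (condY P W) - 1); [lra|right].
  have : s.2 * ln 2 < info P W (condY P W) + R12 * ln 2.
    by rewrite info_condY // mulrC [ln 2 * condmutinf_X1_Y_X2 _ _]mulrC -mulrDl mulrC ltr_pM2r ?ln2_gt0.
  move: (info _ _ _) => I sI'; exists ((I + s.2 * ln 2 - R12 * ln 2) / 2); [lra|left; lra].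
have [d [K [ddelta hK]]] := bad_prob delta0 g1I g2I.
have [K1 hK1] := joint_confusion_rate s10 s20 hg1.
have [K2 hK2] := conference_confusion_rate s20 hg2.
have codes n : exists C : Defs.code X1 X2 Y n (msize n s.1) (msize n s.2) (msize n R12),
    (0 < n)%N -> perr P W C delta <= (K + K1 + K2) / n%:R.
  have [C hC] := random_code HP0 HP1 HW0 HW1 n (msize_gt0 n s.1) (msize_gt0 n s.2)
    (msize_gt0 n R12) ddelta (expR_gt0 (n%:R * g1)) (expR_gt0 (n%:R * g2)).
  exists C => n0; apply: le_trans hC _.
  by rewrite !mulrDl !lerD ?hK ?hK1 ?hK2.
exists (fun n => projT1 (cid (codes n))); apply/cvgr0Pnorm_le => e e0; near=> n.
have n0 : (0 < n)%N by near: n; exact: nbhs_infty_gt.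
rewrite ger0_norm ?perr_ge0 //; apply: le_trans (projT2 (cid (codes n)) n0) _.
rewrite ler_pdivrMr ?ltr0n // -ler_pdivrMl // mulrC.
by near: n; exact: nbhs_infty_ger.
Unshelve. all: by end_near. Qed.

End Achievability.

(** * Closure of the set of achievable pairs *)

Theorem theorem8 (R : realType) (X1 X2 Y : finType)
  (P : X1 -> X2 -> R) (W : X1 -> X2 -> Y -> R)
  (HP0 : forall x1 x2, 0 <= P x1 x2)
  (HP1 : \sum_(x1 : X1) \sum_(x2 : X2) P x1 x2 = 1)
  (HW0 : forall x1 x2 y, 0 <= W x1 x2 y)
  (HW1 : forall x1 x2, \sum_(y : Y) W x1 x2 y = 1)
  (R12 : R) (HR12 : 0 <= R12) :
  closure (achievable P W R12) =
  [set r : R * R | [/\ 0 <= r.1, 0 <= r.2,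
      r.1 + r.2 <= mutinf_X1X2_Y P W &
      r.2 <= condmutinf_X1_Y_X2 P W + R12]].
Proof.
apply/seteqP; split => r.
  move=> clr; have near_r (e : R) : 0 < e -> exists s, [/\ achievable P W R12 s,
      `|r.1 - s.1| < e / 2 & `|r.2 - s.2| < e / 2].
    move=> e0; have e20 : 0 < e / 2 by rewrite divr_gt0.
    by have [s [ach [b1 b2]]] := clr _ (nbhsx_ballx r (e / 2) e20); exists s.
  (* Each inequality involves at most two coordinates, each moved by less than [e / 2], so it passes
     to the limit with slack [e]. *)
  split; apply/ler_addgt0Pr => e e0; have [s [ach]] := near_r e e0;
    have [] := achievable_region HP0 HP1 HW0 HW1 HR12 ach;
    rewrite !ltr_norml => ? ? ? ? /andP[? ?] /andP[? ?]; lra.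
move=> [r10 r20 r12 r2] B /nbhs_ballP[e /= e0 eB].
(* A uniform contraction makes each rate inequality strict unless its left side is 0. *)
pose t := e / (e + r.1 + r.2 + 1).
have D0 : 0 < e + r.1 + r.2 + 1 by lra.
have t0 : 0 < t by rewrite divr_gt0.
(* The denominator exceeds [e], [r.1] and [r.2]: hence [t < 1], and the contraction moves each
   coordinate by less than [e]. *)
have tD : t * (e + r.1 + r.2 + 1) = e by rewrite divfK // gt_eqF.
have t1 : t < 1 by nra.
exists ((1 - t) * r.1, (1 - t) * r.2); split; last first.
  apply: eB; split; rewrite /ball /= ger0_norm; nra.
by apply: achievable_interior => //=; nra.
Qed.
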